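(* Let $p>3$ be a prime, let $a\in\mathbb{Z}_p$ with $a\not\equiv0\pmod p$, let $\langle a\rangle_p$ be the least nonnegative residue of $a$ modulo $p$, and let $t=(a-\langle a\rangle_p)/p$. Then $$\sum_{k=0}^{(p-1)/2}\binom ak\binom{-1-a}k\frac{2a+1}{2k+1}\equiv\begin{cases}1+2t+4ptq_p(2)-2pt\big(B_{p-1}(-a)-B_{p-1}\big)\pmod{p^2}&\text{if }\langle a\rangle_p\le\frac{p-1}2,\\ 1+2t+4p(t+1)q_p(2)-2p(t+1)\big(B_{p-1}(-a)-B_{p-1}\big)\pmod{p^2}&\text{if }\langle a\rangle_p>\frac{p-1}2.\end{cases}$$
   Context: $\mathbb{Z}_p$ denotes the set of rational numbers whose denominator is not divisible by $p$; congruences modulo $p^m$ are taken in $\mathbb{Z}_p$. For $a\in\mathbb{Z}_p$, $\langle a\rangle_p\in\{0,1,\dots,p-1\}$ satisfies $\langle a\rangle_p\equiv a\pmod p$. $\binom xk=x(x-1)\cdots(x-k+1)/k!$. $q_p(2)=(2^{p-1}-1)/p$. The Bernoulli numbers are defined by $B_0=1$ and $\sum_{k=0}^{n-1}\binom nkB_k=0$ ($n\ge2$), and the Bernoulli polynomials by $B_n(x)=\sum_{k=0}^n\binom nkB_kx^{n-k}$. *)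

(* Defs.v *)
From mathcomp Require Import all_boot all_order all_algebra.

Set Implicit Arguments.
Unset Strict Implicit.
Unset Printing Implicit Defensive.

Import Order.TTheory GRing.Theory Num.Theory.
Local Open Scope ring_scope.

Definition Zp_int (p : nat) : {pred rat} := [pred x : rat | ~~ (p%:Z %| denq x)%Z].

(* A congruence in Zp relates elements of Zp, so it includes the p-integrality
   of both sides. *)
Definition eqmodZp (p m : nat) (x y : rat) : bool :=
  [&& x \in Zp_int p, y \in Zp_int p & (x - y) / p%:R ^+ m \in Zp_int p].

(* The least r < p with a = r mod p; see [residue_spec]. *)
Definition residue (p : nat) (a : rat) : nat :=
  find (fun r : nat => eqmodZp p 1 a r%:R) (iota 0 p).

Definition gbinom (x : rat) (k : nat) : rat :=
  (\prod_(i < k) (x - i%:R)) / k`!%:R.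

Definition fermatq (p b : nat) : rat := (b%:R ^+ p.-1 - 1) / p%:R.

(* The list [:: B_0; ...; B_n]; the defining recursion at n.+2, solved for
   B_(n.+1), has the coefficient 'C(n.+2, n.+1) = n.+2; see
   [sum_bernoulli]. *)
Fixpoint bernoulli_seq (n : nat) : seq rat :=
  if n is m.+1 then
    let s := bernoulli_seq m in
    rcons s (- (\sum_(k < m.+1) 'C(m.+2, k)%:R * s`_k) / m.+2%:R)
  else [:: 1].

Definition bernoulli (n : nat) : rat := (bernoulli_seq n)`_n.

Definition bernoulli_poly (n : nat) : {poly rat} :=
  \sum_(k < n.+1) ('C(n, k)%:R * bernoulli k) *: 'X^(n - k).

Lemma bernoulli0 : bernoulli 0 = 1.
Proof. by []. Qed.

Lemma size_bernoulli_seq n : size (bernoulli_seq n) = n.+1.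
Proof. by elim: n => //= n IHn; rewrite size_rcons IHn. Qed.

Lemma nth_bernoulli_seq n k : (k <= n)%N -> (bernoulli_seq n)`_k = bernoulli k.
Proof.
elim: n => [|n IHn]; first by case: k.
rewrite leq_eqVlt => /predU1P[-> //|ltkn].
by rewrite /= nth_rcons size_bernoulli_seq ltkn IHn.
Qed.

Lemma sum_bernoulli n :
  (2 <= n)%N -> \sum_(k < n) 'C(n, k)%:R * bernoulli k = 0.
Proof.
case: n => [|[|n]] // _; rewrite big_ord_recr /= {2}/bernoulli /=.
rewrite nth_rcons size_bernoulli_seq ltnn eqxx binSn.
rewrite mulrCA divff ?pnatr_eq0 // mulr1; apply/eqP; rewrite subr_eq0.
by apply/eqP/eq_bigr => k _; rewrite nth_bernoulli_seq // -ltnS.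
Qed.

Lemma Zp_intE p x (m d : int) :
  ~~ (p%:Z %| d)%Z -> x = m%:~R / d%:~R -> x \in Zp_int p.
Proof.
move=> ndvd xE; rewrite inE; apply: contra (ndvd) => pd.
have d0 : d != 0 by apply: contraNneq ndvd => ->; rewrite dvdz0.
have /eqP : (numq x * d)%:~R = (m * denq x)%:~R :> rat.
  have := divq_num_den x; rewrite {3}xE => /eqP.
  by rewrite eqr_div ?intr_eq0 ?denq_neq0 // -!intrM => /eqP.
rewrite eqr_int => /eqP E.
apply: dvdz_trans pd _; rewrite -(@Gauss_dvdzr _ (numq x)) ?E ?dvdz_mull //.
by rewrite coprimezE coprime_sym coprime_num_den.
Qed.

Lemma residue_spec p a : prime p -> a \in Zp_int p ->
  (residue p a < p)%N /\ eqmodZp p 1 a (residue p a)%:R.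
Proof.
move=> p_pr aZ.
have natZ (r : nat) : r%:R \in Zp_int p.
  apply: (@Zp_intE p _ r 1) => //; last by rewrite divr1.
  by rewrite dvdzE dvdn1 /=; case: eqP p_pr => // ->.
have hasr : has (fun r : nat => eqmodZp p 1 a r%:R) (iota 0 p).
  have p0 : p%:Z != 0 by rewrite eqz_nat -lt0n prime_gt0.
  have cop : coprimez (denq a) p%:Z.
    by rewrite coprimezE coprime_sym /= prime_coprime //; move: aZ; rewrite inE.
  have [[u v] /= uv] := coprimezP _ _ cop.
  pose z := numq a * u; pose r := `|(z %% p)%Z|%N.
  have rE : r%:Z = (z %% p)%Z by rewrite gez0_abs ?modz_ge0.
  apply/hasP; exists r.
    by rewrite mem_iota add0n /= -ltz_nat rE ltz_pmod // ltz_nat prime_gt0.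
  rewrite /eqmodZp aZ natZ expr1 /=.
  apply: (@Zp_intE p _ (numq a * v + (z %/ p)%Z * denq a) (denq a)) => //.
  have zE : z%:~R = (z %/ p)%Z%:~R * p%:R + r%:R :> rat.
    by rewrite {1}(divz_eq z p) -rE rmorphD rmorphM.
  have uvE : u%:~R * (denq a)%:~R + v%:~R * p%:R = 1 :> rat.
    by rewrite -[p%:R]/(p%:Z%:~R) -!rmorphM -rmorphD /= uv.
  have pR : p%:R != 0 :> rat by rewrite pnatr_eq0 -lt0n prime_gt0.
  have dR : (denq a)%:~R != 0 :> rat by rewrite intr_eq0 denq_neq0.
  have aE : a * (denq a)%:~R = (numq a)%:~R by rewrite -{1}(divq_num_den a) divfK.
  apply: (mulIf dR); rewrite divfK //; apply: (mulIf pR).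
  have -> : r%:R = (numq a)%:~R * u%:~R - (z %/ p)%Z%:~R * p%:R :> rat.
    by rewrite -intrM -/z zE addrC addKr.
  rewrite mulrAC divfK // mulrBl aE !(intrD, intrM) mulrDl.
  move: uvE; move: (_ (numq a)) (_ (denq a)) (_ (_ %/ _)%Z) (_ u) (_ v) (p%:R).
  move=> n d q u' v' P uvE; rewrite -[X in X - _]mulr1 -uvE.
  rewrite mulrDr opprD mulNr opprK !mulrDl !mulrA (mulrAC q).
  by rewrite addrA [_ + _ - _]addrAC subrr add0r.
have ltrp : (residue p a < p)%N by rewrite -{2}(size_iota 0 p) -has_find.
by split=> //; have := nth_find 0%N hasr; rewrite nth_iota // add0n.
Qed.

(* Main.v *)
Require Import Defs.
From mathcomp Require Import all_boot all_order all_algebra.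
From mathcomp Require Import ring.

Set Implicit Arguments.
Unset Strict Implicit.

Import GRing.Theory Num.Theory.
Local Open Scope ring_scope.

(* Write n = (p - 1) / 2, F(a) for the left-hand side (a function of a),
   E(a) = \prod_(1 <= i <= n) (1 - a^2 / i^2), and H for harmonic numbers.
   The sum telescopes in a: F(a) - F(a - 1) = 2 E(a). The relation
   (a + 1)(a - n) E(a + 1) = a (a + n + 1) E(a), in which a + n + 1 = a - n + p,
   shows that a E(a) is constant modulo p^2 along a = pt, pt + 1, .., pt + n;
   the constant is pt. As E is even, for a = pt + j with n < j < p it is
   p(t + 1). Hence F(pt + r) - F(pt) is 2pt H_r, respectively
   2pt H_n + 2p(t + 1)(H_r - H_n), modulo p^2, while a direct expansion gives
   F(pt) = 1 + 2t - 2pt H_n. Finally H_n = -2 q_p(2) modulo p, and summing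
   B_(p-1)(x + 1) - B_(p-1)(x) = (p - 1) x^(p-2) gives
   B_(p-1)(-a) - B_(p-1) = -H_r modulo p. *)

(** * Exact identities over the rationals *)

Definition harmonic (n : nat) : rat := \sum_(i < n) i.+1%:R^-1.

Definition square_prod (n : nat) (a : rat) : rat :=
  \prod_(i < n) (1 - (a / i.+1%:R) ^+ 2).

Definition odd_binom_sum (n : nat) (a : rat) : rat :=
  \sum_(0 <= k < n.+1)
     gbinom a k * gbinom (-1 - a) k * ((2 * a + 1) / (2 * k + 1)%:R).

Lemma harmonicS n : harmonic n.+1 = harmonic n + n.+1%:R^-1.
Proof. exact: big_ord_recr. Qed.

Lemma square_prodS n a :
  square_prod n.+1 a = square_prod n a * (1 - (a / n.+1%:R) ^+ 2).
Proof. exact: big_ord_recr. Qed.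

Lemma square_prodN n a : square_prod n (- a) = square_prod n a.
Proof. by apply: eq_bigr => i _; rewrite mulNr sqrrN. Qed.

Lemma natrS_neq0 n : n%:R + 1 != 0 :> rat.
Proof. by rewrite natr1 pnatr_eq0. Qed.

Lemma gbinomS x k : gbinom x k.+1 = gbinom x k * ((x - k%:R) / k.+1%:R).
Proof.
rewrite /gbinom big_ord_recr factS natrM invfM /= [_^-1 * _]mulrC.
by rewrite mulrACA.
Qed.

(** The factors pair up as (a - i)(-1 - a - i) = -(a - i)(a + i + 1). Regrouping a - i with a + i
    for 1 <= i <= k gives the factors a^2 - i^2 and leaves a and a + k + 1 over. *)
Lemma gbinom_mul a k :
  gbinom a k.+1 * gbinom (-1 - a) k.+1
    = - (a / k.+1%:R) * (1 + a / k.+1%:R) * square_prod k a.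
Proof.
elim: k => [|k IHk].
  rewrite !gbinomS /gbinom /square_prod !big_ord0 fact0 !divr1 !subr0.
  by rewrite ?mulr1 ?mul1r; ring.
rewrite gbinomS [gbinom (-1 - a) _]gbinomS mulrACA IHk square_prodS -!natr1.
have k1 := natrS_neq0 k; have k2 := natrS_neq0 k.+1.
by rewrite -natr1 in k2; field; rewrite k1 k2.
Qed.

Lemma odd_binom_sumB1 n a :
  odd_binom_sum n a - odd_binom_sum n (a - 1) = 2 * square_prod n a.
Proof.
rewrite /odd_binom_sum; elim: n => [|n IHn].
  by rewrite !big_nat1 /gbinom /square_prod !big_ord0 fact0 !divr1; ring.
rewrite !(@big_nat_recr _ _ _ n.+1) // opprD addrACA IHn.
(* The product of binomials is invariant under x -> -1 - x, which sends a - 1 to -a. Since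
   [square_prod] is even, the terms at a and a - 1 then share the same [square_prod n a]. *)
have -> : gbinom (a - 1) n.+1 * gbinom (-1 - (a - 1)) n.+1
    = gbinom (- a) n.+1 * gbinom (-1 - - a) n.+1.
  by rewrite [LHS]mulrC; congr (gbinom _ _ * gbinom _ _); ring.
have den : (2 * n.+1 + 1)%:R = 2 * (n%:R + 1) + 1 :> rat.
  by rewrite natr1 natrD natrM.
rewrite den !gbinom_mul square_prodN square_prodS -[n.+1%:R]natr1.
have k1 := natrS_neq0 n.
have k3 : 2 * (n%:R + 1) + 1 != 0 :> rat by rewrite -den addn1 pnatr_eq0.
by field; rewrite k1 k3.
Qed.

(** Up to a constant, E(a) is the product of (i - a)(i + a) for 1 <= i <= n. Passing to a + 1 shifts
    both runs of factors by one, so only their end factors change. The cross-multiplied form avoids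
    dividing by a + 1 or a - n. *)
Lemma square_prod_shift n a :
  (a + 1) * (a - n%:R) * square_prod n (a + 1)
    = a * (a + n%:R + 1) * square_prod n a.
Proof.
elim: n => [|n IHn]; first by rewrite /square_prod !big_ord0; ring.
have k1 := natrS_neq0 n.
have E b : square_prod n.+1 b
    = square_prod n b * (n%:R + 1 - b) * (n%:R + 1 + b) / (n%:R + 1) ^+ 2.
  by rewrite square_prodS -natr1; field.
rewrite !E -natr1; transitivity ((a + 1) * (a - n%:R) * square_prod n (a + 1)
    * ((n%:R + 1 - a) * (n%:R + 2 + a)) / (n%:R + 1) ^+ 2); first by field.
by rewrite IHn; field.
Qed.

Lemma sum_odd_harmonic n :
  \sum_(i < n) i.*2.+1%:R^-1 = harmonic n.*2 - harmonic n / 2.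
Proof.
elim: n => [|n IHn]; first by rewrite /harmonic !big_ord0 mul0r subr0.
rewrite big_ord_recr IHn doubleS !harmonicS /=.
have k1 := natrS_neq0 n.
have -> : n.*2.+2%:R = 2 * (n%:R + 1) :> rat.
  by rewrite -doubleS -mul2n natrM natr1.
by move: (n.*2.+1%:R^-1) => x; rewrite -(@natr1 _ n); field.
Qed.

(** * The difference equation of the Bernoulli polynomials *)

Lemma bin_mul_swap n k j : (k + j <= n)%N ->
  ('C(n, k) * 'C(n - k, j) = 'C(n, j) * 'C(n - j, k))%N.
Proof.
move=> kjn; have kn : (k <= n)%N by apply: leq_trans kjn; apply: leq_addr.
have jn : (j <= n)%N by apply: leq_trans kjn; apply: leq_addl.
have jnk : (j <= n - k)%N by rewrite leq_subRL.
have knj : (k <= n - j)%N by rewrite leq_subRL // addnC.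
apply/eqP; rewrite -(eqn_pmul2r (fact_gt0 k)) -(eqn_pmul2r (fact_gt0 j)).
rewrite -(eqn_pmul2r (fact_gt0 (n - k - j))); apply/eqP.
transitivity n`!; last first.
  by rewrite -(bin_fact jn) -(bin_fact knj) subnAC; ring.
by rewrite -(bin_fact kn) -(bin_fact jnk); ring.
Qed.

Lemma horner_bernoulli_poly n x :
  (bernoulli_poly n).[x]
    = \sum_(k < n.+1) 'C(n, k)%:R * bernoulli k * x ^+ (n - k).
Proof.
by rewrite horner_sum; apply: eq_bigr => k _; rewrite hornerZ hornerXn.
Qed.

Lemma exprD1B n (x : rat) :
  (x + 1) ^+ n - x ^+ n = \sum_(j < n) 'C(n, j)%:R * x ^+ j.
Proof.
rewrite [x + 1]addrC exprDn big_ord_recr /= subnn expr0 mul1r binn mulr1n addrK.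
by apply: eq_bigr => j _; rewrite expr1n mul1r mulr_natl.
Qed.

(** Expanding (x + 1)^(n - k) and exchanging the sums leaves, as coefficient of x^j, a multiple of
    the sum in the defining recursion at n - j. It vanishes unless j = n - 1. *)
Lemma bernoulli_polyD1 n x :
  (bernoulli_poly n).[x + 1] - (bernoulli_poly n).[x] = n%:R * x ^+ n.-1.
Proof.
pose G k j := 'C(n, k)%:R * 'C(n - k, j)%:R * bernoulli k * x ^+ j.
(* The inner range j < n - k is padded with zeros so that the two sums can be exchanged. *)
transitivity (\sum_(k < n.+1) \sum_(j < n) if (j < n - k)%N then G k j else 0).
  rewrite !horner_bernoulli_poly -sumrB; apply: eq_bigr => k _.
  rewrite -mulrBr exprD1B -big_mkcond -(big_ord_widen n (G k)) ?leq_subr //.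
  by rewrite mulr_sumr; apply: eq_bigr => j _; rewrite /G; ring.
rewrite exchange_big /=.
transitivity (\sum_(j < n) 'C(n, j)%:R * x ^+ j *
    \sum_(k < n - j) 'C(n - j, k)%:R * bernoulli k).
  apply: eq_bigr => j _; rewrite mulr_sumr.
  pose H k := 'C(n, j)%:R * x ^+ j * ('C(n - j, k)%:R * bernoulli k).
  rewrite (big_ord_widen n.+1 H).
    rewrite [RHS]big_mkcond; apply: eq_bigr => k _.
    rewrite !ltn_subRL [(j + k)%N]addnC; case: ifP => // /ltnW kj.
    by rewrite /G /H -natrM bin_mul_swap // natrM; ring.
  by apply: leq_trans (leq_subr _ _) _.
case: n G => [|n] G; first by rewrite big_ord0 mul0r.
rewrite big_ord_recr big1 /= => [|j _].
  by rewrite add0r subSnn big_ord1 bernoulli0 bin0 binSn; ring.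
by rewrite sum_bernoulli ?mulr0 // subSn ?ltnS ?subn_gt0 // ltnW.
Qed.

(** Transfers a known membership to another form of the element, leaving an identity for [ring] or
    [field]. *)
Lemma mem_eq (T : Type) (A : {pred T}) (x : T) :
  x \in A -> forall y, x = y -> y \in A.
Proof. by move=> xA y <-. Qed.

(** The ideal p^m Z_p, in the shape of the last conjunct of [eqmodZp]. *)
Definition Zp_ideal (p m : nat) : {pred rat} :=
  [pred x : rat | x / p%:R ^+ m \in Zp_int p].

(** * Arithmetic in Z_p and its ideals *)

Section ZpIdeal.

Variables (p : nat) (p_pr : prime p).
Local Notation P := (p%:R : rat).

Lemma natr_prime_neq0 : P != 0.
Proof. by rewrite pnatr_eq0 -lt0n prime_gt0. Qed.

Lemma Zp_intP x : x \in Zp_int p ->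
  exists m d : int, [/\ ~~ (p%:Z %| d)%Z, d != 0 & x = m%:~R / d%:~R].
Proof.
move=> xZ; exists (numq x), (denq x).
by rewrite denq_neq0 divq_num_den.
Qed.

Lemma ndvdz_mul (d e : int) :
  ~~ (p%:Z %| d)%Z -> ~~ (p%:Z %| e)%Z -> ~~ (p%:Z %| d * e)%Z.
Proof. by rewrite !dvdzE abszM Euclid_dvdM // negb_or => -> ->. Qed.

Lemma Zp_intz (m : int) : m%:~R \in Zp_int p.
Proof.
apply: (@Zp_intE p _ m 1); last by rewrite divr1.
by rewrite dvdzE Euclid_dvd1.
Qed.

Lemma Zp_nat (m : nat) : m%:R \in Zp_int p.
Proof. exact: (Zp_intz m). Qed.

Lemma Zp1 : 1 \in Zp_int p. Proof. exact: (Zp_nat 1). Qed.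

Lemma ZpD x y : x \in Zp_int p -> y \in Zp_int p -> x + y \in Zp_int p.
Proof.
move=> /Zp_intP[m [d [pd d0 ->]]] /Zp_intP[n [e [pe e0 ->]]].
apply: (@Zp_intE p _ (m * e + n * d) (d * e)); first exact: ndvdz_mul.
by rewrite addf_div ?intr_eq0 // !(intrD, intrM).
Qed.

Lemma ZpM x y : x \in Zp_int p -> y \in Zp_int p -> x * y \in Zp_int p.
Proof.
move=> /Zp_intP[m [d [pd d0 ->]]] /Zp_intP[n [e [pe e0 ->]]].
apply: (@Zp_intE p _ (m * n) (d * e)); first exact: ndvdz_mul.
by rewrite mulf_div !intrM.
Qed.

Lemma ZpN x : x \in Zp_int p -> - x \in Zp_int p.
Proof. by move=> xZ; rewrite -mulN1r; apply/ZpM/xZ/(Zp_intz (-1)). Qed.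

Lemma ZpB x y : x \in Zp_int p -> y \in Zp_int p -> x - y \in Zp_int p.
Proof. by move=> xZ yZ; apply/ZpD/ZpN. Qed.

Lemma ZpX x n : x \in Zp_int p -> x ^+ n \in Zp_int p.
Proof.
by move=> xZ; elim: n => [|n IHn]; rewrite ?Zp1 // exprS; apply: ZpM.
Qed.

Lemma Zp_sum I (r : seq I) (Q : pred I) (F : I -> rat) :
  (forall i, Q i -> F i \in Zp_int p) -> \sum_(i <- r | Q i) F i \in Zp_int p.
Proof.
by move=> FZ; elim/big_rec: _ => [|i x /FZ]; [exact: Zp_nat 0 | exact: ZpD].
Qed.

Lemma Zp_prod I (r : seq I) (Q : pred I) (F : I -> rat) :
  (forall i, Q i -> F i \in Zp_int p) -> \prod_(i <- r | Q i) F i \in Zp_int p.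
Proof.
by move=> FZ; elim/big_rec: _ => [|i x /FZ]; [exact: Zp1 | exact: ZpM].
Qed.

Lemma ZpV_nat m : ~~ (p %| m)%N -> m%:R^-1 \in Zp_int p.
Proof. by move=> pm; apply: (@Zp_intE p _ 1 m); rewrite ?div1r. Qed.

Lemma ZpV_lt m : (0 < m < p)%N -> m%:R^-1 \in Zp_int p.
Proof. by case/andP=> m0 mp; apply: ZpV_nat; rewrite gtnNdvd. Qed.

(** Inverses are closed only by assumption, so their integrality must already be in the context. *)
Ltac Zp_ring := repeat lazymatch goal with
  | |- is_true (_ + _ \in _) => apply: ZpD
  | |- is_true (- _ \in _) => apply: ZpN
  | |- is_true (_ * _ \in _) => apply: ZpM
  | |- is_true (_ ^+ _ \in _) => apply: ZpX
  | |- is_true (1 \in _) => exact: Zp1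
  | |- is_true (_%:R \in _) => exact: Zp_nat
  | |- is_true (_ \in _) => assumption
  end.

Lemma Zp_ideal0 m : 0 \in Zp_ideal p m.
Proof. by rewrite inE mul0r (Zp_nat 0). Qed.

Lemma Zp_idealD m x y :
  x \in Zp_ideal p m -> y \in Zp_ideal p m -> x + y \in Zp_ideal p m.
Proof. by rewrite !inE mulrDl; apply: ZpD. Qed.

Lemma Zp_idealN m x : x \in Zp_ideal p m -> - x \in Zp_ideal p m.
Proof. by rewrite !inE mulNr; apply: ZpN. Qed.

Lemma Zp_idealB m x y :
  x \in Zp_ideal p m -> y \in Zp_ideal p m -> x - y \in Zp_ideal p m.
Proof. by move=> xI yI; apply/Zp_idealD/Zp_idealN. Qed.

Lemma Zp_ideal_sum m I (r : seq I) (Q : pred I) (F : I -> rat) :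
  (forall i, Q i -> F i \in Zp_ideal p m) ->
  \sum_(i <- r | Q i) F i \in Zp_ideal p m.
Proof.
move=> FI; elim/big_rec: _ => [|i x /FI]; first exact: Zp_ideal0.
exact: Zp_idealD.
Qed.

Lemma Zp_idealM m k x y :
  x \in Zp_ideal p m -> y \in Zp_ideal p k -> x * y \in Zp_ideal p (m + k).
Proof. by rewrite !inE exprD -mulf_div; apply: ZpM. Qed.

Lemma Zp_idealMl m x y :
  x \in Zp_int p -> y \in Zp_ideal p m -> x * y \in Zp_ideal p m.
Proof. by rewrite !inE -mulrA; apply: ZpM. Qed.

Lemma Zp_idealMr m x y :
  x \in Zp_ideal p m -> y \in Zp_int p -> x * y \in Zp_ideal p m.
Proof. by move=> xI yZ; rewrite mulrC; apply: Zp_idealMl. Qed.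

Lemma Zp_ideal_expM m x : x \in Zp_int p -> P ^+ m * x \in Zp_ideal p m.
Proof.
move=> xZ; rewrite inE mulrAC divff ?mul1r //.
by rewrite expf_neq0 // natr_prime_neq0.
Qed.

Lemma Zp_ideal_int m x : x \in Zp_ideal p m -> x \in Zp_int p.
Proof.
rewrite inE => /(ZpM (ZpX m (Zp_nat p))).
by rewrite mulrCA divff ?mulr1 // expf_neq0 // natr_prime_neq0.
Qed.

Lemma Zp_ideal_dvd m : (p %| m)%N -> m%:R \in Zp_ideal p 1.
Proof.
by case/dvdnP=> k ->; rewrite mulnC natrM -[P]expr1 Zp_ideal_expM ?Zp_nat.
Qed.

(** Here u is a unit, known only through its residue r modulo p. Hence the induction on m: once x is
    in p^m Z_p, the error (u - r) x in replacing u by r lies in p^(m+1) Z_p. *)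
Lemma Zp_ideal_cancel m (r : nat) u x :
  (0 < r < p)%N -> u - r%:R \in Zp_ideal p 1 ->
  u * x \in Zp_ideal p m -> x \in Zp_int p -> x \in Zp_ideal p m.
Proof.
move=> rp uI uxI xZ; have rZ := ZpV_lt rp.
have r0 : r%:R != 0 :> rat by rewrite pnatr_eq0 -lt0n; case/andP: rp.
elim: m uxI => [|m IHm] uxI; first by rewrite inE divr1.
have xI : x \in Zp_ideal p m.
  apply: IHm; rewrite (_ : u * x = P * (u * x / P)); last first.
    by rewrite [RHS]mulrC divfK ?natr_prime_neq0.
  apply: Zp_idealMl; first exact: Zp_nat.
  by move: uxI; rewrite !inE exprS invfM mulrA.
have -> : x = r%:R^-1 * (u * x - (u - r%:R) * x) by field.
apply: Zp_idealMl => //; apply: Zp_idealB => //.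
by rewrite -add1n; apply: Zp_idealM.
Qed.

Lemma Zp_fermat (j : nat) x : (0 < j < p)%N -> x - j%:R \in Zp_ideal p 1 ->
  x ^+ p.-1 - 1 \in Zp_ideal p 1.
Proof.
move=> jp xI.
have xZ : x \in Zp_int p.
  by rewrite -(subrK j%:R x) ZpD ?Zp_nat ?(Zp_ideal_int xI).
(* After multiplication by the unit x, the claim is the chain x^p = j^p = j = x modulo p. *)
apply: (@Zp_ideal_cancel 1 j x) => //; last by rewrite ZpB ?Zp1 ?ZpX.
have -> : x * (x ^+ p.-1 - 1)
    = (x ^+ p - j%:R ^+ p) + (j%:R ^+ p - j%:R) - (x - j%:R).
  by rewrite mulrBr -exprS prednK ?prime_gt0 //; ring.
apply: Zp_idealB => //; apply: Zp_idealD.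
  rewrite subrXX; apply: Zp_idealMr => //.
  by apply: Zp_sum => i _; rewrite ZpM ?ZpX ?Zp_nat.
have [j0 _] := andP jp.
have jle : (j <= j ^ p)%N by rewrite -{1}(expn1 j) leq_pexp2l // prime_gt0.
rewrite -natrX -natrB //; apply: Zp_ideal_dvd.
by rewrite -eqn_mod_dvd // fermat_little.
Qed.

(** * The product E modulo p^2 *)

Variables (n : nat) (p_gt3 : (3 < p)%N) (pE : p = n.*2.+1).

Lemma natr_half : P = 2 * n%:R + 1.
Proof. by rewrite pE -natr1 -mul2n natrM. Qed.

Lemma half_gt0 : (0 < n)%N. Proof. by move: p_gt3; rewrite pE; case: (n). Qed.

Lemma half_lt : (n < p)%N. Proof. by rewrite pE ltnS -addnn leq_addr. Qed.

Lemma natr_gt0_neq0 k : (0 < k)%N -> k%:R != 0 :> rat.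
Proof. by rewrite pnatr_eq0 lt0n. Qed.

Lemma Zp_ideal1_mulp t : t \in Zp_int p -> P * t \in Zp_ideal p 1.
Proof. by rewrite -{1}[P]expr1 => tZ; apply: Zp_ideal_expM. Qed.

Lemma Zp_idealS_mulp m t : t \in Zp_ideal p m -> P * t \in Zp_ideal p m.+1.
Proof.
rewrite -add1n => tI; apply/Zp_idealM/tI => //.
by rewrite -[P]mulr1 Zp_ideal1_mulp ?Zp1.
Qed.

Lemma Zp_harmonic k : (k < p)%N -> harmonic k \in Zp_int p.
Proof.
move=> kp; apply: Zp_sum => // i _; apply: ZpV_lt => //.
by rewrite (leq_ltn_trans _ kp).
Qed.

Lemma Zp_square_prod k a :
  (k < p)%N -> a \in Zp_int p -> square_prod k a \in Zp_int p.
Proof.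
move=> kp aZ; apply: Zp_prod => // i _; apply: ZpB => //; first exact: Zp1.
by apply/ZpX/ZpM => //; apply: ZpV_lt; rewrite // (leq_ltn_trans _ kp).
Qed.

Lemma square_prod_prime k t : (k < p)%N -> t \in Zp_int p ->
  square_prod k (P * t) - 1 \in Zp_ideal p 2.
Proof.
move=> kp tZ; elim: k kp => [|k IHk] kp.
  by rewrite /square_prod big_ord0 subrr Zp_ideal0.
have kZ : k.+1%:R^-1 \in Zp_int p by apply: ZpV_lt.
rewrite square_prodS mulrBr mulr1 addrAC; apply: Zp_idealB => //.
  exact/IHk/ltnW.
apply: Zp_idealMl => //.
  by apply: Zp_square_prod; rewrite ?ZpM ?Zp_nat // ltnW.
by rewrite -mulrA exprMn Zp_ideal_expM ?ZpX ?ZpM.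
Qed.

Lemma square_prod_low r t : (r <= n)%N -> t \in Zp_int p ->
  (P * t + r%:R) * square_prod n (P * t + r%:R) - P * t \in Zp_ideal p 2.
Proof.
move=> rn tZ; elim: r rn => [|r IHr] rn.
  rewrite addr0 -{3}[P * t]mulr1 -mulrBr Zp_idealMl ?ZpM ?Zp_nat //.
  exact: square_prod_prime half_lt tZ.
have {}IHr := IHr (ltnW rn).
rewrite -natr1 addrA; set a := P * t + r%:R in IHr *.
have aZ : a \in Zp_int p by rewrite ZpD ?ZpM ?Zp_nat.
have PtI := Zp_ideal1_mulp tZ.
(* Modulo p, n - a is n - r, a unit because r < n. *)
apply: (@Zp_ideal_cancel _ (n - r) (n%:R - a)).
- by rewrite subn_gt0 rn (leq_ltn_trans (leq_subr _ _) half_lt).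
- rewrite natrB 1?ltnW // (_ : _ - _ = - (P * t)) ?Zp_idealN //.
  by rewrite /a; ring.
(* With a + n + 1 = (a - n) + p, the shift relation expresses the new error by the old one, up to
   p^2 t. *)
- have -> : (n%:R - a) * ((a + 1) * square_prod n (a + 1) - P * t)
      = (n%:R - a) * (a * square_prod n a - P * t)
        - P * (a * square_prod n a - P * t) - P ^+ 2 * t.
    have := square_prod_shift n a; rewrite natr_half.
    move: (square_prod n a) (square_prod n (a + 1)) => x y E.
    transitivity (- ((a + 1) * (a - n%:R) * y)
      - (n%:R - a) * ((2 * n%:R + 1) * t)).
      by ring.
    by rewrite E; ring.
  apply: Zp_idealB; rewrite ?Zp_ideal_expM //.
  by apply: Zp_idealB; rewrite // Zp_idealMl ?ZpB ?Zp_nat.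
- by have EZ := Zp_square_prod half_lt (ZpD aZ Zp1); Zp_ring.
Qed.

(* Apply [square_prod_low] to [-a = p * (-t - 1) + (p - r)]. *)
Lemma square_prod_high r t : (n < r < p)%N -> t \in Zp_int p ->
  (P * t + r%:R) * square_prod n (P * t + r%:R) - P * (t + 1) \in Zp_ideal p 2.
Proof.
case/andP=> nr rp tZ.
have rn : (p - r <= n)%N.
  by rewrite leq_subLR pE -addnn -addSn leq_add2r.
have tZ' : - (t + 1) \in Zp_int p by rewrite ZpN ?ZpD ?Zp1.
have /Zp_idealN := square_prod_low rn tZ'.
have -> : P * - (t + 1) + (p - r)%:R = - (P * t + r%:R).
  by rewrite natrB 1?ltnW //; ring.
by rewrite square_prodN => aI; apply: mem_eq aI _ _; ring.
Qed.

(** As p u already carries a factor p, dividing it by pt + r or by r makes no difference modulo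
    p^2. *)
Lemma square_prod_div r t u : (0 < r < p)%N -> t \in Zp_int p ->
  u \in Zp_int p ->
  (P * t + r%:R) * square_prod n (P * t + r%:R) - P * u \in Zp_ideal p 2 ->
  square_prod n (P * t + r%:R) - P * u / r%:R \in Zp_ideal p 2.
Proof.
move=> rp tZ uZ aI; have rZ := ZpV_lt rp.
have [r0 _] := andP rp; have {}r0 := natr_gt0_neq0 r0.
apply: (@Zp_ideal_cancel _ r (P * t + r%:R)) => //.
- by rewrite addrK Zp_ideal1_mulp.
- have -> : (P * t + r%:R) * (square_prod n (P * t + r%:R) - P * u / r%:R)
      = ((P * t + r%:R) * square_prod n (P * t + r%:R) - P * u)
        - P ^+ 2 * (t * u / r%:R).
    by move: (square_prod _ _) => x; field.
  by rewrite Zp_idealB ?Zp_ideal_expM //; Zp_ring.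
- have aZ : P * t + r%:R \in Zp_int p by Zp_ring.
  by have EZ := Zp_square_prod half_lt aZ; Zp_ring.
Qed.

(** * The sum F modulo p^2 *)

Lemma harmonic_prime : harmonic p.-1 \in Zp_ideal p 1.
Proof.
have p0 := prime_gt0 p_pr.
apply: (@Zp_ideal_cancel _ 2 2).
- by rewrite (ltn_trans _ p_gt3).
- by rewrite subrr Zp_ideal0.
(* Adding the reversed sum pairs 1/i with 1/(p - i), and 1/i + 1/(p - i) = p / (i (p - i)). *)
- rewrite mulr_natl mulr2n {2}/harmonic (reindex_inj rev_ord_inj) /=.
  rewrite -big_split Zp_ideal_sum // => i _ /=.
  have ip : (i.+1 < p)%N by rewrite -ltn_predRL.
  have jE : ((p.-1 - i.+1).+1 = p - i.+1)%N.
    by rewrite -subSn ?prednK // -ltnS prednK.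
  have iZ : i.+1%:R^-1 \in Zp_int p by apply: ZpV_lt.
  have jZ : (p - i.+1)%:R^-1 \in Zp_int p.
    by apply: ZpV_lt; rewrite // subn_gt0 ip ltn_subrL p0.
  rewrite jE (_ : _ + _ = P * (i.+1%:R^-1 * (p - i.+1)%:R^-1)).
    by rewrite Zp_ideal1_mulp ?ZpM.
  have i0 : i.+1%:R != 0 :> rat by rewrite pnatr_eq0.
  have : (p - i.+1)%:R != 0 :> rat by rewrite natr_gt0_neq0 // subn_gt0.
  rewrite natrB 1?ltnW //; move: (i.+1%:R : rat) i0 => x x0 y0.
  by field; rewrite x0 y0.
- by rewrite Zp_harmonic // ltn_predL.
Qed.

(** With a = pt, [gbinom_mul] shows that modulo p^2 the term at 0 < k < n is linear in a. At k = n
    the denominator 2k + 1 is p and cancels the p of a, leaving -t/n. The linear terms add up by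
    harmonic numbers. *)
Lemma odd_binom_sum_prime t : t \in Zp_int p ->
  odd_binom_sum n (P * t) - (1 + 2 * t - 2 * P * t * harmonic n)
    \in Zp_ideal p 2.
Proof.
move=> tZ; have := half_gt0; have np := half_lt; have PE := natr_half.
case: n np PE pE => // m mp PE pEm _; set a := P * t.
have aI : a \in Zp_ideal p 1 by apply: Zp_ideal1_mulp.
have aZ : a \in Zp_int p by rewrite ZpM ?Zp_nat.
have P0 : P != 0 by apply: natr_prime_neq0.
have n0 : m.+1%:R != 0 :> rat by rewrite pnatr_eq0.
have nZ : m.+1%:R^-1 \in Zp_int p by apply: ZpV_lt.
pose c (i : nat) : rat := i.+1%:R^-1 - 2 * i.+1.*2.+1%:R^-1.
pose s : rat := \sum_(i < m) c i.
(* The odd reciprocals start at 1/3 and stop at 1/(p - 2); the missing 1/1 produces the final 2. *)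
have sE : s = 2 * harmonic m.+1 - m.+1%:R^-1 - 2 * harmonic p.-1 + 2.
  have oddE : \sum_(i < m) i.+1.*2.+1%:R^-1
      = harmonic p.-1 - harmonic m.+1 / 2 - 1.
    by rewrite pEm -sum_odd_harmonic big_ord_recl invr1 addrC addKr.
  rewrite /s sumrB -mulr_sumr oddE harmonicS -[\sum_(i < m) _]/(harmonic m).
  by move: (m.+1%:R^-1 : rat) => x; field.
have oddn0 k : k.*2.+1%:R != 0 :> rat by rewrite pnatr_eq0.
have oddE k : (2 * k + 1)%:R = k.*2.+1%:R :> rat by rewrite -mul2n addn1.
have EZ k : (k < p)%N -> square_prod k a \in Zp_int p.
  by move=> kp; apply: Zp_square_prod.
have mid i : (i < m)%N -> gbinom a i.+1 * gbinom (-1 - a) i.+1 *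
    ((2 * a + 1) / (2 * i.+1 + 1)%:R) + a * c i \in Zp_ideal p 2.
  move=> im; rewrite oddE gbinom_mul /c.
  have i0 : i.+1%:R != 0 :> rat by rewrite pnatr_eq0.
  have ip : (i < p)%N by rewrite (ltn_trans im) // (ltn_trans _ mp).
  have iZ : i.+1%:R^-1 \in Zp_int p.
    by apply: ZpV_lt; rewrite // (leq_ltn_trans im) // (ltn_trans _ mp).
  have jZ : i.+1.*2.+1%:R^-1 \in Zp_int p.
    by apply: ZpV_lt; rewrite // pEm !ltnS ltn_double.
  have EI := square_prod_prime ip tZ.
  have E1 := EZ i ip.
  set x : rat := i.+1%:R^-1 in iZ *; set y : rat := i.+1.*2.+1%:R^-1 in jZ *.
  set E := square_prod i a in E1 EI *.
  (* For k = i + 1 this is 1/k - 2/(2k + 1) = 1/(k (2k + 1)), the coefficient of -a in the term. *)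
  have xy : x - 2 * y = x * y.
    move: (oddn0 i.+1) i0; rewrite /x /y -(@natr1 rat i.+1.*2) -mul2n natrM.
    by move: (i.+1%:R : rat) => z o0 z0; field; rewrite o0.
  have -> : - (a * x) * (1 + a * x) * E * ((2 * a + 1) * y) + a * (x - 2 * y)
      = - (x * y * (1 + a * x) * (2 * a + 1) * a * (E - 1))
        - P ^+ 2 * (t ^+ 2 * x * y * (x + 2 + 2 * a * x)).
    by rewrite xy /a; ring.
  by rewrite Zp_idealB ?Zp_ideal_expM ?Zp_idealN ?Zp_idealMl //; Zp_ring.
have top : gbinom a m.+1 * gbinom (-1 - a) m.+1 *
    ((2 * a + 1) / (2 * m.+1 + 1)%:R) + t / m.+1%:R \in Zp_ideal p 2.
  rewrite oddE gbinom_mul -pEm.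
  have mp' := ltnW mp.
  have EI := square_prod_prime mp' tZ.
  have E1 := EZ m mp'.
  set E := square_prod m a in E1 EI *.
  have -> : - (a / m.+1%:R) * (1 + a / m.+1%:R) * E * ((2 * a + 1) / P)
        + t / m.+1%:R
      = - (t / m.+1%:R * (1 + a / m.+1%:R) * (2 * a + 1) * (E - 1))
        - P ^+ 2 * (t / m.+1%:R * (t / m.+1%:R + 2 * t ^+ 2 / m.+1%:R)).
    rewrite /a; move: P0 n0; rewrite PE.
    by move: (m.+1%:R : rat) => z P0 z0; field; rewrite P0 z0.
  by rewrite Zp_idealB ?Zp_ideal_expM ?Zp_idealN ?Zp_idealMl //; Zp_ring.
rewrite /odd_binom_sum big_nat_recr // big_nat_recl // big_mkord.
set T0 := (X in X + _ + _ - _); set T1 := (X in _ + X + _ - _).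
set T2 := (X in _ + X - _).
have T0E : T0 = 2 * a + 1.
  by rewrite /T0 /gbinom !big_ord0 fact0 !divr1 !mul1r.
have T1I : T1 + a * s \in Zp_ideal p 2.
  rewrite /s mulr_sumr -big_split; apply: Zp_ideal_sum => // i _.
  exact: mid.
(* The 2a of [T0] cancels against the 2 in [sE], while -t/n and pt/n combine to (p - 1)t/n = 2t.
   What remains is a multiple of p H_(p-1). *)
have -> : T0 + T1 + T2 - (1 + 2 * t - 2 * P * t * harmonic m.+1)
   = (T1 + a * s) + (T2 + t / m.+1%:R) + P * (2 * t * harmonic p.-1).
  rewrite T0E sE /a PE; move: (m.+1%:R : rat) n0 => z z0.
  by move: (harmonic _) (harmonic _) => h h'; field.
apply: Zp_idealD; first exact: Zp_idealD.
apply: Zp_idealS_mulp; rewrite Zp_idealMl ?harmonic_prime //.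
by Zp_ring.
Qed.

Lemma odd_binom_sumS r t u : (r.+1 < p)%N -> t \in Zp_int p ->
  u \in Zp_int p ->
  (P * t + r.+1%:R) * square_prod n (P * t + r.+1%:R) - P * u
    \in Zp_ideal p 2 ->
  odd_binom_sum n (P * t + r.+1%:R) - odd_binom_sum n (P * t + r%:R)
    - 2 * P * u / r.+1%:R \in Zp_ideal p 2.
Proof.
move=> rp tZ uZ EI; have {}rp : (0 < r.+1 < p)%N by [].
have := Zp_idealMl (Zp_nat 2) (square_prod_div rp tZ uZ EI).
rewrite mulrBr -odd_binom_sumB1.
by rewrite !mulrA -natr1 addrA addrK.
Qed.

Lemma odd_binom_sum_low r t : (r <= n)%N -> t \in Zp_int p ->
  odd_binom_sum n (P * t + r%:R)
    - (1 + 2 * t + 2 * P * t * (harmonic r - harmonic n))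
    \in Zp_ideal p 2.
Proof.
move=> rn tZ; elim: r rn => [|r IHr] rn.
  rewrite addr0 [harmonic 0]big_ord0 sub0r mulrN.
  exact: odd_binom_sum_prime.
have rp : (r.+1 < p)%N by apply: leq_ltn_trans rn half_lt.
have := odd_binom_sumS rp tZ tZ (square_prod_low rn tZ).
move=> /Zp_idealD /(_ (IHr (ltnW rn))) FI; apply: mem_eq FI _ _.
by rewrite harmonicS; ring.
Qed.

Lemma odd_binom_sum_high r t : (n <= r < p)%N -> t \in Zp_int p ->
  odd_binom_sum n (P * t + r%:R)
    - (1 + 2 * t + 2 * P * (t + 1) * (harmonic r - harmonic n))
    \in Zp_ideal p 2.
Proof.
move=> /andP[nr rp] tZ; elim: r nr rp => [|r IHr].
  by rewrite leqn0 => /eqP n0; have := half_gt0; rewrite n0.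
(* The induction starts at r = n, where H_r - H_n = 0 and the formulas with t and t + 1 agree. *)
rewrite leq_eqVlt => /predU1P[<- _|nr rp].
  have := odd_binom_sum_low (leqnn n) tZ.
  by rewrite !subrr !mulr0.
have nrp : (n < r.+1 < p)%N by rewrite nr.
have t1 : t + 1 \in Zp_int p by Zp_ring.
have := odd_binom_sumS rp tZ t1 (square_prod_high nrp tZ).
move=> /Zp_idealD /(_ (IHr nr (ltnW rp))) FI; apply: mem_eq FI _ _.
by rewrite harmonicS; ring.
Qed.

(** * Harmonic numbers and the Fermat quotient modulo p *)

Lemma sum_alternating_harmonic m :
  \sum_(i < m.*2) (-1) ^+ i / i.+1%:R = harmonic m.*2 - harmonic m.
Proof.
elim: m => [|m IHm]; first by rewrite /harmonic !big_ord0 subrr.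
have -> : m.+1.*2 = m.*2.+2 by [].
have sgn : (-1) ^+ m.*2 = 1 :> rat by rewrite -signr_odd odd_double.
rewrite !big_ord_recr IHm !harmonicS /= exprS sgn.
rewrite -doubleS -(mul2n m.+1) natrM invfM.
by move: (m.+1%:R^-1 : rat) (m.*2.+1%:R^-1) => x y; field.
Qed.

(** By Pascal's rule two neighbouring coefficients of row p - 1 add up to one of row p, which p
    divides; so the sign alternates. *)
Lemma Zp_bin_prime i : (i < p)%N ->
  'C(p.-1, i)%:R - (-1) ^+ i \in Zp_ideal p 1.
Proof.
elim: i => [|i IHi] ip; first by rewrite bin0 subrr Zp_ideal0.
have /(prime_dvd_bin p_pr) /Zp_ideal_dvd : (0 < i.+1 < p)%N by [].
move=> /Zp_idealB /(_ (IHi (ltnW ip))) FI; apply: mem_eq FI _ _.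
rewrite -{1}[p]prednK ?prime_gt0 // binS natrD exprS.
by move: (_%:R) (_%:R) => x y; ring.
Qed.

Lemma sum_bin_proper m :
  \sum_(i < m) 'C(m.+1, i.+1)%:R = 2 ^+ m.+1 - 2 :> rat.
Proof.
rewrite -[X in X ^+ _]/(1 + 1) exprDn big_ord_recr big_ord_recl /=.
rewrite bin0 binn !expr1n !mulr1 !mulr1n.
under [X in _ = _ + X + _ - _]eq_bigr do rewrite !expr1n mulr1.
by move: (\sum_(i < m) _) => s; ring.
Qed.

(** Expand 2^p - 2 into the inner binomials of row p and use (i + 1) C(p, i + 1) = p C(p - 1, i). *)
Lemma fermatq2E :
  2 * fermatq p 2 = \sum_(i < p.-1) 'C(p.-1, i)%:R / i.+1%:R.
Proof.
have P0 := natr_prime_neq0; have p0 := prime_gt0 p_pr.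
apply: (mulfI P0); rewrite /fermatq mulrCA [P * (_ / P)]mulrC.
rewrite divfK // mulrBr mulr1.
rewrite -exprS -sum_bin_proper prednK // mulr_sumr; apply: eq_bigr => i _.
rewrite mulrA -natrM mul_bin_diag natrM.
by rewrite mulrAC divff ?mul1r // pnatr_eq0.
Qed.

(** Replacing C(p - 1, i) by (-1)^i turns 2 q_p(2) into the alternating sum H_(p-1) - H_n, and
    H_(p-1) vanishes modulo p. *)
Lemma harmonic_fermatq : harmonic n + 2 * fermatq p 2 \in Zp_ideal p 1.
Proof.
have FI : harmonic p.-1 + \sum_(i < p.-1) ('C(p.-1, i)%:R - (-1) ^+ i) / i.+1%:R
    \in Zp_ideal p 1.
  apply: Zp_idealD; first exact: harmonic_prime.
  apply: Zp_ideal_sum => // i _; have ip : (i.+1 < p)%N by rewrite -ltn_predRL.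
  by rewrite Zp_idealMr ?Zp_bin_prime ?ZpV_lt // ltnW.
apply: mem_eq FI _ _; rewrite fermatq2E.
under eq_bigr do rewrite mulrBl.
rewrite sumrB; set S := \sum_(i < p.-1) _.
rewrite (_ : p.-1 = n.*2) ?pE // sum_alternating_harmonic; ring.
Qed.

(** * Bernoulli polynomial values modulo p *)

Lemma Zp_bernoulli k : (k < p.-1)%N -> bernoulli k \in Zp_int p.
Proof.
elim/ltn_ind: k => -[|k] IHk kp; first by rewrite bernoulli0 Zp1.
have k0 : k.+2%:R != 0 :> rat by rewrite pnatr_eq0.
have := sum_bernoulli (isT : 2 <= k.+2)%N.
rewrite big_ord_recr /= binSn => /eqP.
rewrite addrC addr_eq0 => /eqP BE.
have -> : bernoulli k.+1
    = - (\sum_(i < k.+1) 'C(k.+2, i)%:R * bernoulli i) / k.+2%:R.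
  by rewrite -BE mulrAC divff // mul1r.
(* The divisor stays below p; only at [bernoulli p.-1] would the recursion divide by p. *)
have kV : k.+2%:R^-1 \in Zp_int p by apply: ZpV_lt; rewrite -ltn_predRL.
apply: ZpM => //; apply: ZpN; apply: Zp_sum => i _.
by apply: ZpM; [exact: Zp_nat | apply: IHk; rewrite // (ltn_trans _ kp)].
Qed.

Lemma bernoulli_poly_harmonic r t : (r < p)%N -> t \in Zp_int p ->
  (bernoulli_poly p.-1).[- (P * t + r%:R)] - bernoulli p.-1 + harmonic r
    \in Zp_ideal p 1.
Proof.
move=> rp tZ; elim: r rp => [|r IHr] rp.
  (* At -pt the constant term B_(p-1) cancels in the difference, so its integrality is not at issue;
     every other term carries a factor pt. *)
  rewrite addr0 [harmonic 0]big_ord0 addr0 horner_bernoulli_poly.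
  rewrite big_ord_recr /= subnn binn mul1r expr0 mulr1 addrK.
  apply: Zp_ideal_sum => // k _; apply: Zp_idealMl.
    by apply: ZpM; [exact: Zp_nat | exact: Zp_bernoulli].
  have PtI : - (P * t) \in Zp_ideal p 1 by apply/Zp_idealN/Zp_ideal1_mulp.
  by rewrite -(subnSK (ltn_ord k)) exprS; apply: Zp_idealMr => //; Zp_ring.
set y := P * t + r.+1%:R.
have yI : y - r.+1%:R \in Zp_ideal p 1 by rewrite addrK; apply: Zp_ideal1_mulp.
have rV : r.+1%:R^-1 \in Zp_int p by apply: ZpV_lt.
have yZ : y \in Zp_int p by rewrite /y; Zp_ring.
have r0 : r.+1%:R != 0 :> rat by rewrite pnatr_eq0.
(* Multiplied by y, the second term is -(p - 1) y^(p-1) because p - 2 is odd, and this is 1 modulo p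
   by Fermat. *)
have powI : r.+1%:R^-1 - p.-1%:R * (- y) ^+ p.-1.-1 \in Zp_ideal p 1.
  apply: (@Zp_ideal_cancel _ r.+1 y) => //; last by Zp_ring.
  have p1 : (0 < p.-1)%N by rewrite ltn_predRL (ltn_trans _ p_gt3).
  have yE : y * (- y) ^+ p.-1.-1 = - y ^+ p.-1.
    rewrite -[y in y * _]opprK mulNr -exprS prednK // exprNn.
    by rewrite -signr_odd pE /= odd_double mul1r.
  have PE : p.-1%:R = P - 1 by rewrite -subn1 natrB // prime_gt0.
  rewrite mulrBr mulrCA yE PE.
  have FI : (y - r.+1%:R) / r.+1%:R - (y ^+ p.-1 - 1) + P * y ^+ p.-1
      \in Zp_ideal p 1.
    apply: Zp_idealD; last by apply: Zp_ideal1_mulp; Zp_ring.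
    by apply: Zp_idealB; rewrite ?Zp_idealMr // (@Zp_fermat r.+1).
  by apply: mem_eq FI _ _; field; rewrite addrC natr1.
apply: mem_eq (Zp_idealD (IHr (ltnW rp)) powI) _ _.
have := bernoulli_polyD1 p.-1 (- y).
have -> : - y + 1 = - (P * t + r%:R) by rewrite /y -natr1; ring.
by move=> <-; rewrite harmonicS; ring.
Qed.

(** * Assembly of the two cases *)

Lemma Zp_fermatq2 : fermatq p 2 \in Zp_int p.
Proof.
have p2 : (0 < 2 < p)%N by rewrite (ltn_trans _ p_gt3).
have : 2 - 2%:R \in Zp_ideal p 1 by rewrite subrr Zp_ideal0.
by move=> /(Zp_fermat p2); rewrite [_ \in Zp_ideal _ _]inE expr1.
Qed.

(** Covers both cases, with u = t or u = t + 1. The factor p in front lifts the congruences for H_r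
    and H_n from modulus p to p^2. *)
Lemma eqmodZp_harmonic r t u x :
  (r < p)%N -> t \in Zp_int p -> u \in Zp_int p ->
  x - (1 + 2 * t + 2 * P * u * (harmonic r - harmonic n)) \in Zp_ideal p 2 ->
  eqmodZp p 2 x (1 + 2 * t + 4 * P * u * fermatq p 2 - 2 * P * u *
    ((bernoulli_poly p.-1).[- (P * t + r%:R)] - bernoulli p.-1)).
Proof.
move=> rp tZ uZ xI; have DI := bernoulli_poly_harmonic rp tZ.
set D := _ - bernoulli _ in DI *.
have qZ := Zp_fermatq2; have HZ := Zp_harmonic rp.
have DZ : D \in Zp_int p.
  by rewrite -(addrK (harmonic r) D) ZpB ?(Zp_ideal_int DI).
set y := 1 + 2 * t + 4 * P * u * fermatq p 2 - 2 * P * u * D.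
have yZ : y \in Zp_int p by rewrite /y; Zp_ring.
have xyI : x - y \in Zp_ideal p 2.
  have corr : P * (2 * u * ((D + harmonic r) - (harmonic n + 2 * fermatq p 2)))
      \in Zp_ideal p 2.
    apply: Zp_idealS_mulp; apply: Zp_idealMl; first by Zp_ring.
    by rewrite Zp_idealB ?harmonic_fermatq.
  by apply: mem_eq (Zp_idealD xI corr) _ _; rewrite /y; ring.
apply/and3P; split=> //.
by rewrite -(subrK y x) ZpD // (Zp_ideal_int xyI).
Qed.

End ZpIdeal.

Theorem theorem4p1 (p : nat) (a : rat)
    (p_prime : prime p) (p_gt3 : (3 < p)%N)
    (a_int : a \in Zp_int p) (a_neq0 : ~~ eqmodZp p 1 a 0) :
  let t : rat := (a - (residue p a)%:R) / p%:R in
  let S : rat := \sum_(0 <= k < (p.-1 %/ 2).+1)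
      gbinom a k * gbinom (-1 - a) k * ((2 * a + 1) / (2 * k + 1)%:R) in
  let D : rat := (bernoulli_poly p.-1).[- a] - bernoulli p.-1 in
  ((residue p a <= p.-1 %/ 2)%N ->
     eqmodZp p 2 S
       (1 + 2 * t + 4 * p%:R * t * fermatq p 2 - 2 * p%:R * t * D))
  /\
  ((p.-1 %/ 2 < residue p a)%N ->
     eqmodZp p 2 S
       (1 + 2 * t + 4 * p%:R * (t + 1) * fermatq p 2
          - 2 * p%:R * (t + 1) * D)).
Proof.
set n := (p.-1 %/ 2)%N; set r := residue p a => t S D.
(* The last conjunct of the residue congruence is exactly the integrality of t. *)
have [rp /and3P[_ _ tZ]] := residue_spec p_prime a_int.
rewrite expr1 -/r -/t in rp tZ.
have pE : p = n.*2.+1.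
  have [p2|p_odd] := even_prime p_prime; first by rewrite p2 in p_gt3.
  rewrite /n divn2 -[in LHS](odd_double_half p) p_odd add1n.
  by case: (p) p_odd => //= q; rewrite uphalf_half => /negPf ->.
have aE : a = p%:R * t + r%:R.
  by rewrite /t mulrC divfK ?subrK // natr_prime_neq0.
have DE : D = (bernoulli_poly p.-1).[- (p%:R * t + r%:R)] - bernoulli p.-1.
  by rewrite -aE.
have SE : S = odd_binom_sum n (p%:R * t + r%:R) by rewrite -aE.
rewrite SE DE; split=> rn; apply: (eqmodZp_harmonic p_prime p_gt3 pE) => //.
- exact: odd_binom_sum_low.
- by rewrite ZpD ?Zp1.
- by apply: odd_binom_sum_high => //; rewrite ltnW.
Qed.
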